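(* Let $m=\alpha n$ with $0<\alpha<1$, and let $\rho_n(z)$ denote the Kac-Rice density of zeros of the random harmonic polynomial $F(z)=p_n(z)+\overline{q_m(z)}$ sampled from the truncated model. Then $\rho_n$ has the following pointwise asymptotics as $n\to\infty$: (i) for $|z|<\sqrt{\alpha/(1-\alpha)}$, $$\rho_n(z)\sim\frac{n^{3/2}|z|}{2\pi(1+|z|^2)^2};$$ (ii) for $|z|>\sqrt{\alpha/(1-\alpha)}$, $$\rho_n(z)\sim\frac{n}{\pi(1+|z|^2)^2}.$$ Thus the leading contribution of zeros is located within the distance $\sqrt{\alpha/(1-\alpha)}$ from the origin.
   Context: Truncated model: $$p_n(z)=\sum_{k=0}^n a_k z^k,\qquad q_m(z)=\sum_{k=0}^m b_k z^k,$$ where $a_k$ and $b_k$ are independent centered complex Gaussian random variables with $\mathbb{E}\, a_j\overline{a_k}=\delta_{jk}\binom{n}{j}$ and $\mathbb{E}\, b_j\overline{b_k}=\delta_{jk}\binom{n}{k}$. The Kac-Rice density $\rho_n$ is the density, with respect to Lebesgue measure $dA$ on $\mathbb{C}$, of the expected number of zeros: for a domain $T\subset\mathbb{C}$, the expected number of zeros of $F$ in $T$ is $\int_T\rho_n(z)\,dA(z)$. Explicitly, $$\rho_n(z)=\frac{1}{\pi|z|^2}\,\frac{R_1^2+R_2^2-2R_{12}^2}{R_3^2\sqrt{(R_1+R_2)^2-4R_{12}^2}},$$ where, with $P_{m,n}(x):=\sum_{k=0}^m\binom{n}{k}x^k$, \begin{align*} R_{12} &= n^2|z|^4(1+|z|^2)^{n-1}P_{m-1,n-1}(|z|^2),\\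 R_3 &= (1+|z|^2)^n+P_{m,n}(|z|^2),\\ R_1 &= R_3\,(n^2|z|^4+n|z|^2)(1+|z|^2)^{n-2}-n^2|z|^4(1+|z|^2)^{2n-2},\\ R_2 &= R_3\left[n^2|z|^4P_{m-2,n-2}(|z|^2)+n|z|^2P_{m-1,n-2}(|z|^2)\right]-n^2|z|^4\left[P_{m-1,n-1}(|z|^2)\right]^2. \end{align*} The notation $A_n\sim B_n$ means $A_n/B_n\to1$ as $n\to\infty$.
   Formalization: In (i) the point z = 0 is excluded, since there the right-hand side is 0 (so the ratio is undefined) and the explicit formula divides by |z|^2; m is taken as the integer part of αn. *)

(* Defs.v *)
From HB Require Import structures.
From mathcomp Require Import all_boot all_order all_algebra.
From mathcomp Require Import all_classical all_reals all_analysis.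
From mathcomp.real_closed Require Import complex.
Set Implicit Arguments.
Unset Strict Implicit.
Unset Printing Implicit Defensive.
Import Order.TTheory GRing.Theory Num.Theory.
Import numFieldNormedType.Exports.
Local Open Scope classical_set_scope.
Local Open Scope ring_scope.

(* The modulus of z as an element of R (`|z| is an element of R[i]). *)
Notation cmod := ComplexField.Normc.normc.

Definition asymp_equiv (R : realType) (A B : nat -> R) : Prop :=
  (fun n => A n / B n) @ \oo --> (1 : R).

(* The real part (c = false) or the imaginary part (c = true) of a
   complex-valued function. *)
Definition cpart (R : realType) (T : Type) (c : bool) (f : T -> R[i]) (w : T) : R :=
  if c then complex.Im (f w) else complex.Re (f w).

Section Model.
Context (R : realType) (d : measure_display) (T : measurableType d)
        (P : probability T R).

(* Mutual independence of a finite family of real random variables; finite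
   subfamilies are covered by taking B i = setT. *)
Definition mutually_independent (I : finType) (X : I -> T -> R) : Prop :=
  forall B : I -> set R, (forall i, measurable (B i)) ->
    P (\bigcap_i (X i @^-1` B i)) = (\prod_(i : I) P (X i @^-1` B i))%E.

(* X has law N(0, v); normal_prob takes the standard deviation. *)
Definition centered_gaussian (v : R) (X : T -> R) : Prop :=
  measurable_fun setT X /\
  forall B : set R, measurable B -> P (X @^-1` B) = normal_prob 0 (Num.sqrt v) B.

(* (Circularly symmetric) complex Gaussians of variance E|a_k|^2 = C(n,k) and
   E|b_k|^2 = C(n,k): the real and imaginary parts of all the coefficients
   a_0, .., a_n, b_0, .., b_m are independent, each of variance C(n,k)/2.
   The variance of b_k involves n, not m. *)
Definition coef (n m : nat) (a b : nat -> T -> R[i]) (i : 'I_n.+1 + 'I_m.+1) :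
    T -> R[i] :=
  match i with inl k => a k | inr k => b k end.

Definition coef_index (n m : nat) (i : 'I_n.+1 + 'I_m.+1) : nat :=
  match i with inl k => k | inr k => k end.

Definition truncated_model (n m : nat) (a b : nat -> T -> R[i]) : Prop :=
  (forall (i : 'I_n.+1 + 'I_m.+1) (c : bool),
     centered_gaussian ('C(n, coef_index i)%:R / 2) (cpart c (coef a b i))) /\
  mutually_independent
    (fun ic : ('I_n.+1 + 'I_m.+1) * bool => cpart ic.2 (coef a b ic.1)).

Definition harmonic_poly (n m : nat) (a b : nat -> T -> R[i]) (w : T)
    (z : R[i]) : R[i] :=
  \sum_(k < n.+1) a k w * z ^+ k + (\sum_(k < m.+1) b k w * z ^+ k)^*%C.

(* counting A is the cardinality of A, and +oo when A is infinite. *)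
Definition expected_zeros (F : T -> R[i] -> R[i]) (D : set R[i]) : \bar R :=
  (\int[P]_w counting [set z | D z /\ (F w z = 0)%R])%E.

(* Domains of C are given as subsets of R * R, which carries the topology and
   the area measure dA. *)
Definition is_zero_density (F : T -> R[i] -> R[i]) (rho : R[i] -> R) : Prop :=
  forall U : set (R * R), open U -> connected U ->
    expected_zeros F [set z | U (complex.Re z, complex.Im z)] =
    (\int[lebesgue_measure \x lebesgue_measure]_(u in U)
       (rho (Complex u.1 u.2))%:E)%E.

End Model.

Section Formula.
Variable R : realType.

(* P_{m,n}(x); m : int because the indices m-1 and m-2 may be negative, in
   which case the sum is empty. Terms with k > n vanish. *)
Definition trunc_binom (m : int) (n : nat) (x : R) : R :=
  \sum_(k < n.+1 | k%:Z <= m) 'C(n, k)%:R * x ^+ k.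

Variables (n m : nat) (z : R[i]).
Let x : R := cmod z ^+ 2.
Let N : R := n%:R.
(* Integer exponents, so that n - 2 is meaningful for n < 2. *)
Let pw (e : int) : R := (1 + x) ^ e.

Definition KR12 : R :=
  N ^+ 2 * x ^+ 2 * pw (n%:Z - 1) * trunc_binom (m%:Z - 1) (n - 1) x.
Definition KR3 : R := pw n%:Z + trunc_binom m%:Z n x.
Definition KR1 : R :=
  KR3 * (N ^+ 2 * x ^+ 2 + N * x) * pw (n%:Z - 2)
  - N ^+ 2 * x ^+ 2 * pw (2 * n%:Z - 2).
Definition KR2 : R :=
  KR3 * (N ^+ 2 * x ^+ 2 * trunc_binom (m%:Z - 2) (n - 2) x
         + N * x * trunc_binom (m%:Z - 1) (n - 2) x)
  - N ^+ 2 * x ^+ 2 * trunc_binom (m%:Z - 1) (n - 1) x ^+ 2.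

Definition kac_rice_formula : R :=
  (pi * cmod z ^+ 2)^-1 *
  ((KR1 ^+ 2 + KR2 ^+ 2 - 2 * KR12 ^+ 2) /
   (KR3 ^+ 2 * Num.sqrt ((KR1 + KR2) ^+ 2 - 4 * KR12 ^+ 2))).

End Formula.

(* A density is only determined almost everywhere; the second clause singles
   out the explicit version, off the origin, where the formula makes sense. *)
Definition kac_rice_density (R : realType) (d : measure_display)
    (T : measurableType d) (P : probability T R) (n m : nat)
    (F : T -> R[i] -> R[i]) (rho : R[i] -> R) : Prop :=
  is_zero_density P F rho /\
  forall z : R[i], z != 0 -> rho z = kac_rice_formula n m z.

(* Main.v *)
Require Import Defs.
From HB Require Import structures.
From mathcomp Require Import all_boot all_order all_algebra.
From mathcomp Require Import all_classical all_reals all_analysis.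
From mathcomp.real_closed Require Import complex.
From mathcomp Require Import ring lra.
Import Order.TTheory GRing.Theory Num.Theory.
Import numFieldNormedType.Exports.
Local Open Scope classical_set_scope.
Local Open Scope ring_scope.

(** Off the origin the density is given by an explicit formula, so the theorem
is a statement about that formula.  Write [x = |z|^2], [p = x / (1 + x)] and
[D = (1 + x)^n].  Each truncated binomial sum is [(1 + x)^N] times a
probability [P(S_N <= j)], where [S_N] is binomial with parameters [N] and [p].
The formula is homogeneous, and all powers of [D] cancel
([kac_rice_formula_norm]).  What remains is a rational expression, with one
square root, in [n], [p] and four such probabilities [A], [B], [C], [E], whose
truncation indices are [alpha n] up to bounded errors.

The condition [|z| < sqrt (alpha / (1 - alpha))] says exactly [p < alpha], in
which case the truncation lies above the mean [n p] and the four probabilities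
tend to [1]; when [alpha < p] they tend to [0].  In both cases the Chernoff bound
([chernoff_bound], [chernoff_rate_lt1]) gives an exponential rate, and all that
is used of it is that [n] times the error tends to [0].

Outside the disc, [R_1 / (n D^2)] tends to [p (1 - p)] while [R_2] and [R_12]
are [o(n D^2)], so the quotient is of order [n] ([kr_quot_cvg_linear]).  Inside
the disc, the normalized [R_1], [R_2] and [R_12] are all equivalent to
[n^2 p^2], and both the numerator and the expression under the square root
vanish at leading order.  They are governed by the differences [R_1 - R_12] and
[R_2 - R_12], both equivalent to [2 n p (1 - p)]; the numerator and the
discriminant are then of order [n^3] and the quotient of order [n^(3/2)]
([kr_quot_near_diag], [kr_quot_cvg_superlinear]).  The last clause follows by
comparing [n] with [n^(3/2)]. *)

(** * Binomial tails *)

(** The probability that a binomial variable with parameters [N] and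
[x / (1 + x)] satisfies [Q]. *)
Definition binom_weight {R : realType} (Q : pred nat) (N : nat) (x : R) : R :=
  (\sum_(k < N.+1 | Q k) 'C(N, k)%:R * x ^+ k) / (1 + x) ^+ N.

(** The expectation of [exp (- s (X - alpha))] for [X] Bernoulli of parameter
[p]. *)
Definition chernoff_rate {R : realType} (alpha p s : R) : R :=
  (1 - p) * expR (alpha * s) + p * expR (- ((1 - alpha) * s)).

Lemma expR_le_inv {R : realType} (u : R) : u < 1 -> expR u <= (1 - u)^-1.
Proof.
move=> u1; rewrite -[u in expR u]opprK expRN lef_pV2 ?posrE ?expR_gt0 ?subr_gt0//.
exact: expR_ge1Dx.
Qed.

(** The rate equals [1] at [s = 0] and has derivative [alpha - p] there, so it is
below [1] for some small [s] of the sign of [p - alpha].  Bounding both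
exponentials by [expR_le_inv] reduces the claim to
[alpha (1 - alpha) s ^+ 2 < (p - alpha) s], which [s = p - alpha] satisfies for
either sign. *)
Lemma chernoff_rate_lt1 {R : realType} (alpha p : R) :
  0 < alpha < 1 -> 0 < p < 1 -> p != alpha ->
  chernoff_rate alpha p (p - alpha) < 1.
Proof.
move=> /andP[a0 a1] /andP[p0 p1] pa; rewrite /chernoff_rate.
set s := p - alpha.
have s20 : 0 < s ^+ 2 by rewrite exprn_even_gt0//= subr_eq0.
have u1 : alpha * s < 1 by rewrite /s; nra.
have v1 : - ((1 - alpha) * s) < 1 by rewrite /s; nra.
apply: le_lt_trans (lerD (ler_wpM2l _ (expR_le_inv _ u1))
                         (ler_wpM2l _ (expR_le_inv _ v1))) _; [lra|lra|].
have -> : (1 - p) / (1 - alpha * s) + p / (1 - - ((1 - alpha) * s)) =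
  ((1 - p) * (1 + (1 - alpha) * s) + p * (1 - alpha * s)) /
  ((1 - alpha * s) * (1 + (1 - alpha) * s)).
  by field; apply/andP; split; apply/negP => /eqP; lra.
rewrite ltr_pdivrMr; last by apply: mulr_gt0; lra.
rewrite mul1r -subr_gt0.
have -> : (1 - alpha * s) * (1 + (1 - alpha) * s) -
  ((1 - p) * (1 + (1 - alpha) * s) + p * (1 - alpha * s)) =
  s ^+ 2 * (1 - alpha * (1 - alpha)) by rewrite /s; ring.
by apply: mulr_gt0 => //; nra.
Qed.

Lemma binom_weight_ge0 {R : realType} (Q : pred nat) N (x : R) :
  0 < x -> 0 <= binom_weight Q N x.
Proof.
move=> x0; apply: divr_ge0; last by apply: exprn_ge0; lra.
by apply: sumr_ge0 => k _; rewrite mulr_ge0// exprn_ge0// ltW.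
Qed.

Lemma binom_weightC {R : realType} (Q : pred nat) N (x : R) :
  0 < x -> binom_weight Q N x = 1 - binom_weight (predC Q) N x.
Proof.
move=> x0; apply/eqP; rewrite eq_sym subr_eq -mulrDl eq_sym; apply/eqP.
have -> : \sum_(k < N.+1 | Q k) 'C(N, k)%:R * x ^+ k +
    \sum_(k < N.+1 | predC Q k) 'C(N, k)%:R * x ^+ k = (1 + x) ^+ N.
  rewrite exprDn [RHS](bigID (fun k : 'I_N.+1 => Q k))/=.
  by congr (_ + _); apply: eq_bigr => k _; rewrite expr1n mul1r mulr_natl.
by rewrite divff// expf_neq0//; apply/negP => /eqP; lra.
Qed.

(** On [Q] the weight [exp (c - s (k - alpha n))] is at least [1]; inserting it and
extending the sum to all [k] leaves a binomial expansion.  The sign of [s] is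
free, so the bound covers both tails; the shift [i] and the slack [c] absorb the
bounded shifts of the indices in the formula. *)
Lemma chernoff_bound {R : realType} (x alpha s c : R) (n i : nat) (Q : pred nat) :
  0 < x -> (i <= n)%N ->
  (forall k, Q k -> s * (k%:R - alpha * n%:R) <= c) ->
  binom_weight Q (n - i) x <=
    expR (c + alpha * s * i%:R) * chernoff_rate alpha (x / (1 + x)) s ^+ (n - i).
Proof.
move=> x0 lein hQ; set N := (n - i)%N.
have nE : n%:R = N%:R + i%:R :> R by rewrite -natrD subnK.
have x1 : 1 + x != 0 by apply/negP => /eqP; lra.
have -> : chernoff_rate alpha (x / (1 + x)) s =
    expR (alpha * s) * (1 + x * expR (- s)) / (1 + x).
  rewrite /chernoff_rate.
  have -> : - ((1 - alpha) * s) = alpha * s + (- s) by ring.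
  by rewrite expRD; field.
rewrite expr_div_n mulrA ler_wpM2r//; first by rewrite invr_ge0 exprn_ge0//; lra.
rewrite exprMn -expRM_natr mulrA -expRD exprDn mulr_sumr big_mkcond/=.
apply: ler_sum => k _.
rewrite expr1n mul1r exprMn -expRM_natr -[X in _ <= _ * X]mulr_natl.
have pos : 0 <= 'C(N, k)%:R * x ^+ k by rewrite mulr_ge0// exprn_ge0// ltW.
have -> (u v w y : R) : u * (v * (w * y)) = v * w * (u * y) by ring.
rewrite -expRD.
case: ifP => [Qk|_]; last by rewrite mulr_ge0// expR_ge0.
rewrite ler_peMr// -[leLHS]expR0 ler_expR.
by have := hQ _ Qk; rewrite nE; lra.
Qed.

(** With [r = exp (- 2 c)], one factor [exp (- c n)] is at most [1 / (c n)] and the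
other one still tends to [0]. *)
Lemma nat_mul_geom_cvg0 {R : realType} (r : R) : 0 < r < 1 ->
  (fun n : nat => n%:R * r ^+ n) @ \oo --> (0 : R).
Proof.
move=> /andP[r0 r1]; pose c := - ln r / 2.
have c0 : 0 < c by rewrite divr_gt0// oppr_gt0 ln_lt0// r0.
have rE : r = expR (- c) * expR (- c).
  by rewrite -expRD /c -[LHS]lnK ?posrE//; congr expR; field.
apply: (@squeeze_cvgr _ _ _ _ (fun=> 0) (fun n => c^-1 * expR (- c) ^+ n)).
- near=> n; apply/andP; split; first by rewrite mulr_ge0// exprn_ge0// ltW.
  rewrite {1}rE exprMn mulrA ler_wpM2r// ?exprn_ge0 ?expR_ge0//.
  rewrite -expRM_natr mulNr expRN ler_pdivrMr ?expR_gt0//.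
  rewrite -ler_pdivrMl ?invr_gt0// invrK.
  by apply: le_trans (expR_ge1Dx _); rewrite lerDr.
- exact: cvg_cst.
- rewrite -[X in _ --> X](mulr0 c^-1); apply: cvgM; first exact: cvg_cst.
  by apply: cvg_expr; rewrite ger0_norm ?expR_ge0// expR_lt1 oppr_lt0.
Unshelve. all: by end_near.
Qed.

Lemma binom_weight_negl {R : realType} (x alpha s c : R) (i : nat)
    (Q : nat -> pred nat) :
  0 < x -> chernoff_rate alpha (x / (1 + x)) s < 1 ->
  (forall n k, Q n k -> s * (k%:R - alpha * n%:R) <= c) ->
  (fun n => n%:R * binom_weight (Q n) (n - i) x) @ \oo --> (0 : R).
Proof.
move=> x0 r1 hQ; set r := chernoff_rate _ _ _ in r1.
have p0 : 0 < x / (1 + x) by rewrite divr_gt0//; lra.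
have p1 : x / (1 + x) < 1 by rewrite ltr_pdivrMr; lra.
have r0 : 0 < r.
  by rewrite /r /chernoff_rate addr_gt0// mulr_gt0 ?expR_gt0//; lra.
pose K := expR (c + alpha * s * i%:R) / r ^+ i.
apply: (@squeeze_cvgr _ _ _ _ (fun=> 0) (fun n => K * (n%:R * r ^+ n))).
- near=> n; have lein : (i <= n)%N by near: n; exact: nbhs_infty_ge.
  rewrite mulr_ge0 ?binom_weight_ge0//= [leRHS]mulrCA ler_wpM2l//.
  apply: le_trans (chernoff_bound x alpha s c n i _ x0 lein (hQ n)) _.
  rewrite -/r /K -[in r ^+ n](subnK lein) exprD -[leRHS]mulrA ler_wpM2l ?expR_ge0//.
  by rewrite mulrCA mulVf ?mulr1// expf_neq0// gt_eqF.
- exact: cvg_cst.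
- rewrite -[X in _ --> X](mulr0 K); apply: cvgM; first exact: cvg_cst.
  by apply: nat_mul_geom_cvg0; rewrite r0.
Unshelve. all: by end_near.
Qed.

Section Tails.
Context {R : realType} (alpha x : R) (m : nat -> nat) (i : nat) (j : int).
Hypotheses (halpha : 0 < alpha < 1) (x0 : 0 < x).
Hypothesis hm : forall n, m n = Num.truncn (alpha * n%:R).

Let p := x / (1 + x).
Let below n : pred nat := fun k => (k%:Z <= (m n)%:Z - j)%R.

Let p01 : 0 < p < 1.
Proof.
have x1 : 0 < 1 + x by rewrite addr_gt0.
by rewrite /p divr_gt0//= ltr_pdivrMr//; lra.
Qed.

Let mP n : (m n)%:R <= alpha * n%:R < (m n).+1%:R.
Proof. by rewrite hm truncn_itv// mulr_ge0//; case/andP: halpha => /ltW. Qed.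

Lemma binom_weight_lower : alpha < p ->
  (fun n => n%:R * binom_weight (below n) (n - i) x) @ \oo --> (0 : R).
Proof.
move=> ap; apply: (@binom_weight_negl _ _ alpha (p - alpha)
  ((p - alpha) * - j%:~R)) => //.
  by apply: chernoff_rate_lt1 => //; rewrite gt_eqF.
move=> n k; rewrite /below -(ler_int R) intrB => hk.
rewrite ler_wpM2l ?subr_ge0 ?(ltW ap)//.
by have /andP[+ _] := mP n; move: hk; rewrite -!pmulrn; lra.
Qed.

(** The complementary event [m n - j < k] forces [alpha n - j < k], because
[alpha n < m n + 1]; the slack is therefore the same as for the lower tail. *)
Lemma binom_weight_upper : p < alpha ->
  (fun n => n%:R * (1 - binom_weight (below n) (n - i) x)) @ \oo --> (0 : R).
Proof.
move=> ap; under eq_fun do rewrite binom_weightC// opprB addrC subrK.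
apply: (@binom_weight_negl _ _ alpha (p - alpha)
  ((p - alpha) * - j%:~R)) => //.
  by apply: chernoff_rate_lt1 => //; rewrite lt_eqF.
move=> n k /=; rewrite /below -ltNge -lezD1 -(ler_int R) intrD intrB => hk.
rewrite ler_wnM2l ?subr_le0 ?(ltW ap)//.
by have /andP[_ +] := mP n; move: hk; rewrite -!pmulrn -natr1; lra.
Qed.

End Tails.

(** * Normalized form of the Kac-Rice formula *)

Definition kr_quot {R : realType} (r3 r1 r2 r12 : R) : R :=
  (r1 ^+ 2 + r2 ^+ 2 - 2 * r12 ^+ 2) /
  (r3 ^+ 2 * Num.sqrt ((r1 + r2) ^+ 2 - 4 * r12 ^+ 2)).

(** [norm_R12], [norm_R1] and [norm_R2] are [KR12], [KR1] and [KR2] divided by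
[(1 + x) ^+ (2 * n)], in terms of [N = n], [p = x / (1 + x)] and the binomial
probabilities [A], [B], [C], [E]. *)
Definition norm_R12 {R : realType} (N p B : R) : R := (N * p) ^+ 2 * B.

Definition norm_R1 {R : realType} (N p A : R) : R :=
  (N * p) ^+ 2 * A + (1 + A) * (N * p * (1 - p)).

Definition norm_R2 {R : realType} (N p A B C E : R) : R :=
  (1 + A) * ((N * p) ^+ 2 * C + N * p * (1 - p) * E) - (N * p * B) ^+ 2.

Lemma kr_quot_scale {R : realType} (c d r3 r1 r2 r12 : R) : 0 < c -> d != 0 ->
  kr_quot (d * r3) (c * r1) (c * r2) (c * r12) =
  c / d ^+ 2 * kr_quot r3 r1 r2 r12.
Proof.
move=> c0 d0; rewrite /kr_quot.
have -> : (c * r1 + c * r2) ^+ 2 - 4 * (c * r12) ^+ 2 =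
  c ^+ 2 * ((r1 + r2) ^+ 2 - 4 * r12 ^+ 2) by ring.
rewrite sqrtrM ?sqr_ge0// sqrtr_sqr gtr0_norm//.
set S := Num.sqrt _.
have -> : (c * r1) ^+ 2 + (c * r2) ^+ 2 - 2 * (c * r12) ^+ 2 =
  c ^+ 2 * (r1 ^+ 2 + r2 ^+ 2 - 2 * r12 ^+ 2) by ring.
rewrite exprMn.
move: (r1 ^+ 2 + _ - _) (d ^+ 2) (r3 ^+ 2) => X Y V.
rewrite !invfM; transitivity ((c / c) * (c / Y * (X * (V^-1 / S)))).
  by ring.
by rewrite mulfV ?gt_eqF// mul1r.
Qed.

Definition binom_cdf {R : realType} (j : int) (N : nat) (x : R) : R :=
  binom_weight (fun k => k%:Z <= j) N x.

Lemma trunc_binomE {R : realType} (j : int) (N : nat) (x : R) : 0 < x ->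
  trunc_binom j N x = (1 + x) ^+ N * binom_cdf j N x.
Proof.
move=> x0; rewrite /binom_cdf /binom_weight mulrC mulfVK//.
by rewrite expf_neq0// gt_eqF// addr_gt0.
Qed.

(** The trivial shifts in [A] give the four probabilities the common shape
[binom_cdf (m%:Z - j) (n - i) x], to which the tail estimates apply. *)
Lemma kac_rice_formula_norm {R : realType} (n m : nat) (z : R[i])
    (x := cmod z ^+ 2) (p := x / (1 + x))
    (A := binom_cdf (m%:Z - 0) (n - 0) x)
    (B := binom_cdf (m%:Z - 1) (n - 1) x)
    (C := binom_cdf (m%:Z - 2) (n - 2) x)
    (E := binom_cdf (m%:Z - 1) (n - 2) x) : 0 < x -> (2 <= n)%N ->
  kac_rice_formula n m z =
  (pi * x)^-1 * kr_quot (1 + A) (norm_R1 n%:R p A)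
    (norm_R2 n%:R p A B C E) (norm_R12 n%:R p B).
Proof.
move=> x0 n2; rewrite /kac_rice_formula -/x; congr (_ * _).
have x1 : 1 + x != 0 by rewrite gt_eqF// addr_gt0.
pose D := (1 + x) ^+ n.
have D0 : 0 < D by rewrite exprn_gt0// addr_gt0.
have D1 : D != 0 by rewrite gt_eqF.
have e0 : (1 + x) ^ n%:Z = D by [].
have e1 : (1 + x) ^ (n%:Z - 1) = D / (1 + x) by rewrite expfzDr.
have e2 : (1 + x) ^ (n%:Z - 2) = D / (1 + x) ^+ 2 by rewrite expfzDr.
have e22 : (1 + x) ^ (2 * n%:Z - 2) = D ^+ 2 / (1 + x) ^+ 2.
  by rewrite expfzDr// mulrC [2 * _]mulrC -exprz_exp mulrC.
have f1 : (1 + x) ^+ (n - 1) = D / (1 + x).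
  by rewrite exprB ?unitfE// (leq_trans _ n2).
have f2 : (1 + x) ^+ (n - 2) = D / (1 + x) ^+ 2.
  by rewrite exprB ?unitfE.
have E3 : KR3 n m z = D * (1 + A).
  by rewrite /KR3 -/x e0 trunc_binomE// /A subr0 subn0 -/D; ring.
have E12 : KR12 n m z = D ^+ 2 * norm_R12 n%:R p B.
  rewrite /KR12 -/x e1 trunc_binomE// f1 -/B /norm_R12 /p; field; exact: x1.
have E1 : KR1 n m z = D ^+ 2 * norm_R1 n%:R p A.
  rewrite /KR1 -/x E3 e2 e22 /norm_R1 /p; field; exact: x1.
have E2 : KR2 n m z = D ^+ 2 * norm_R2 n%:R p A B C E.
  rewrite /KR2 -/x E3 !trunc_binomE// f1 f2 -/B -/C -/E /norm_R2 /p; field; exact: x1.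
rewrite E3 E12 E1 E2 -/(kr_quot _ _ _ _) kr_quot_scale ?(exprn_gt0 2 D0)//.
by rewrite divff ?mul1r// expf_neq0.
Qed.

(** * Limits of the normalized quotient *)

(** Lets the shape of a limit be computed by the rules for sums and products,
and be identified afterwards. *)
Lemma cvg_to_eq {R : realType} (f : nat -> R) (l l' : R) :
  f @ \oo --> l -> l = l' -> f @ \oo --> l'.
Proof. by move=> ? <-. Qed.

Lemma cvg_ratio {R : realType} (num r3 disc : nat -> R) (u v d : R) :
  v != 0 -> 0 < d ->
  num @ \oo --> u -> r3 @ \oo --> v -> disc @ \oo --> d ->
  (fun n => num n / (r3 n ^+ 2 * Num.sqrt (disc n))) @ \oo -->
    u / (v ^+ 2 * Num.sqrt d).
Proof.
move=> v0 d0 hu hv hd; apply: cvgM => //; apply: cvgV.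
  by rewrite mulf_neq0 ?expf_neq0// gt_eqF// sqrtr_gt0.
apply: cvgM; first by rewrite !expr2; apply: cvgM.
by apply: continuous_cvg => //; exact: sqrt_continuous.
Qed.

Lemma inv_nat_cvg0 {R : realType} : (fun n : nat => n%:R^-1) @ \oo --> (0 : R).
Proof.
apply/(@gtr0_cvgV0 R nat \oo _ (fun n => n%:R)); last exact: cvgr_idn.
by exists 1%N => // n /=; rewrite ltr0n.
Qed.

Lemma cvg0_of_nat_mul {R : realType} (u : nat -> R) :
  (fun n => n%:R * u n) @ \oo --> (0 : R) -> u @ \oo --> (0 : R).
Proof.
move=> hu; apply: cvg_trans (near_eq_cvg _) _; last first.
  apply: cvg_to_eq; first exact: cvgM inv_nat_cvg0 hu.
  by rewrite mul0r.
by near=> n => /=; rewrite mulKf// pnatr_eq0 -lt0n; near: n; exact: nbhs_infty_gt.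
Unshelve. all: by end_near.
Qed.

(** When [r1], [r2] and [r12] share their term of order [N ^+ 2] and differ by terms
of order [N], the numerator and the discriminant factor through the differences
[N * u1] and [N * u2], each times a term of order [N ^+ 2].  This exposes the
cancellation of the terms of order [N ^+ 4]. *)
Lemma kr_quot_near_diag {R : realType} (N r3 u1 u2 w : R) : 0 < N ->
  kr_quot r3 (N ^+ 2 * w + N * u1) (N ^+ 2 * w + N * u2) (N ^+ 2 * w) =
  (N * Num.sqrt N) *
  ((u1 * (2 * w + N^-1 * u1) + u2 * (2 * w + N^-1 * u2)) /
   (r3 ^+ 2 * Num.sqrt ((u1 + u2) * (4 * w + N^-1 * (u1 + u2))))).
Proof.
move=> N0; rewrite /kr_quot; have N1 : N != 0 by rewrite gt_eqF.
set num := u1 * _ + _; set disc := (u1 + u2) * _.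
have -> : (N ^+ 2 * w + N * u1) ^+ 2 + (N ^+ 2 * w + N * u2) ^+ 2
    - 2 * (N ^+ 2 * w) ^+ 2 = N ^+ 3 * num.
  by rewrite /num; field.
have -> : (N ^+ 2 * w + N * u1 + (N ^+ 2 * w + N * u2)) ^+ 2
    - 4 * (N ^+ 2 * w) ^+ 2 = N ^+ 2 * N * disc.
  by rewrite /disc; field.
rewrite sqrtrM ?mulr_ge0 ?sqr_ge0 ?ltW// sqrtrM ?sqr_ge0// sqrtr_sqr gtr0_norm//.
have S0 : Num.sqrt N != 0 by rewrite gt_eqF// sqrtr_gt0.
have NE : N ^+ 3 = N * Num.sqrt N * (N * Num.sqrt N).
  by rewrite mulrACA -!expr2 sqr_sqrtr ?ltW// -exprSr.
rewrite NE; set T := N * Num.sqrt N.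
have T0 : T != 0 by rewrite mulf_neq0.
set V := r3 ^+ 2; set W := Num.sqrt disc.
rewrite [V * _]mulrCA invfM.
transitivity (T * T^-1 * (T * (num * (V * W)^-1))); first by ring.
by rewrite mulfV// mul1r.
Qed.

Section Limits.
Context {R : realType} (p : R) (A B C E : nat -> R).
Hypothesis p01 : 0 < p < 1.

(** After division by [n], the entry [norm_R1] tends to [p (1 - p)], and the entries
[norm_R2] and [norm_R12] tend to [0]. *)
Lemma kr_quot_cvg_linear :
  (fun n => n%:R * A n) @ \oo --> (0 : R) -> (fun n => n%:R * B n) @ \oo --> (0 : R) ->
  (fun n => n%:R * C n) @ \oo --> (0 : R) -> (fun n => n%:R * E n) @ \oo --> (0 : R) ->
  (fun n => kr_quot (1 + A n) (norm_R1 n%:R p (A n))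
    (norm_R2 n%:R p (A n) (B n) (C n) (E n)) (norm_R12 n%:R p (B n)) / n%:R)
   @ \oo --> p * (1 - p).
Proof.
move=> nA nB nC nE.
have [cA cB cE] : [/\ A @ \oo --> (0 : R), B @ \oo --> (0 : R) & E @ \oo --> (0 : R)].
  by split; exact: cvg0_of_nat_mul.
have pq0 : 0 < p * (1 - p) by case/andP: p01 => *; rewrite mulr_gt0 ?subr_gt0.
have c1 (u : R) : (fun _ : nat => u) @ \oo --> u by exact: cvg_cst.
pose s1 n := p ^+ 2 * (n%:R * A n) + (1 + A n) * (p * (1 - p)).
pose s2 n := (1 + A n) * (p ^+ 2 * (n%:R * C n) + p * (1 - p) * E n)
             - p ^+ 2 * (n%:R * B n * B n).
pose s12 n := p ^+ 2 * (n%:R * B n).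
have h3 : (fun n => 1 + A n) @ \oo --> (1 + 0 : R) by apply: cvgD.
have h1 : s1 @ \oo --> p * (1 - p).
  apply: cvg_to_eq; first exact: (cvgD (cvgM (c1 _) nA) (cvgM h3 (c1 _))).
  ring.
have h2 : s2 @ \oo --> (0 : R).
  apply: cvg_to_eq.
    exact: (cvgB (cvgM h3 (cvgD (cvgM (c1 _) nC) (cvgM (c1 _) cE)))
                 (cvgM (c1 _) (cvgM nB cB))).
  ring.
have h12 : s12 @ \oo --> (0 : R).
  apply: cvg_to_eq; first exact: (cvgM (c1 _) nB).
  ring.
apply: cvg_trans (near_eq_cvg _) _; last first.
  apply: cvg_to_eq.
    apply: (@cvg_ratio _ (fun n => s1 n * s1 n + s2 n * s2 n - 2 * (s12 n * s12 n))
      (fun n => 1 + A n)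
      (fun n => (s1 n + s2 n) * (s1 n + s2 n) - 4 * (s12 n * s12 n))
      _ (1 + 0) ((p * (1 - p)) ^+ 2)) => //.
    - by rewrite exprn_gt0.
    - exact: (cvgB (cvgD (cvgM h1 h1) (cvgM h2 h2)) (cvgM (c1 _) (cvgM h12 h12))).
    - apply: cvg_to_eq.
        exact: (cvgB (cvgM (cvgD h1 h2) (cvgD h1 h2)) (cvgM (c1 _) (cvgM h12 h12))).
      ring.
  rewrite sqrtr_sqr gtr0_norm//; case/andP: p01 => p0 p1; field.
  by rewrite subr_eq0 !gt_eqF.
near=> n.
have n0 : 0 < n%:R :> R by rewrite ltr0n; near: n; exact: nbhs_infty_gt.
have -> : norm_R1 n%:R p (A n) = n%:R * s1 n by rewrite /norm_R1 /s1; ring.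
have -> : norm_R2 n%:R p (A n) (B n) (C n) (E n) = n%:R * s2 n.
  by rewrite /norm_R2 /s2; ring.
have -> : norm_R12 n%:R p (B n) = n%:R * s12 n by rewrite /norm_R12 /s12; ring.
rewrite -[X in kr_quot X _ _ _]mul1r kr_quot_scale ?oner_neq0// expr1n divr1.
by rewrite [n%:R * _]mulrC mulfK ?gt_eqF// /kr_quot !expr2.
Unshelve. all: by end_near.
Qed.

(** The entries [norm_R12], [norm_R1] and [norm_R2] are [n ^+ 2 * w],
[n ^+ 2 * w + n * u1] and [n ^+ 2 * w + n * u2], with [w] tending to [p ^+ 2] and both [u1] and [u2] to
[2 p (1 - p)]. *)
Lemma kr_quot_cvg_superlinear :
  (fun n => n%:R * (1 - A n)) @ \oo --> (0 : R) ->
  (fun n => n%:R * (1 - B n)) @ \oo --> (0 : R) ->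
  (fun n => n%:R * (1 - C n)) @ \oo --> (0 : R) ->
  (fun n => n%:R * (1 - E n)) @ \oo --> (0 : R) ->
  (fun n => kr_quot (1 + A n) (norm_R1 n%:R p (A n))
    (norm_R2 n%:R p (A n) (B n) (C n) (E n)) (norm_R12 n%:R p (B n))
     / (n%:R * Num.sqrt n%:R))
   @ \oo --> p * Num.sqrt (p * (1 - p)) / 2.
Proof.
move=> na nb nc ne.
have c1 (u : R) : (fun _ : nat => u) @ \oo --> u by exact: cvg_cst.
have [ca cb cc ce] : [/\ (fun n => 1 - A n) @ \oo --> (0 : R),
   (fun n => 1 - B n) @ \oo --> (0 : R), (fun n => 1 - C n) @ \oo --> (0 : R) &
   (fun n => 1 - E n) @ \oo --> (0 : R)] by split; exact: cvg0_of_nat_mul.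
have /andP[p0 p1] := p01.
have pq0 : 0 < p * (1 - p) by rewrite mulr_gt0 ?subr_gt0.
have h3 : (fun n => 2 - (1 - A n)) @ \oo --> (2 - 0 : R) by exact: cvgB.
(* Written through [1 - A], ..., [1 - E], so that every product with [n] is a
   product of [n] with a vanishing tail. *)
pose w n := p ^+ 2 * (1 - (1 - B n)).
pose u1 n := p ^+ 2 * (n%:R * (1 - B n) - n%:R * (1 - A n))
             + (2 - (1 - A n)) * (p * (1 - p)).
pose u2 n := p ^+ 2 * (n%:R * (1 - A n) * (1 - C n) - n%:R * (1 - A n)
               + 3 * (n%:R * (1 - B n)) - n%:R * (1 - B n) * (1 - B n)
               - 2 * (n%:R * (1 - C n)))
             + (2 - (1 - A n)) * (p * (1 - p) * (1 - (1 - E n))).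
have hw : w @ \oo --> p ^+ 2.
  apply: cvg_to_eq; first exact: (cvgM (c1 _) (cvgB (c1 _) cb)).
  ring.
have h1 : u1 @ \oo --> 2 * (p * (1 - p)).
  apply: cvg_to_eq; first exact: (cvgD (cvgM (c1 _) (cvgB nb na)) (cvgM h3 (c1 _))).
  ring.
have h2 : u2 @ \oo --> 2 * (p * (1 - p)).
  apply: cvg_to_eq.
    exact: (cvgD (cvgM (c1 _)
      (cvgB (cvgB (cvgD (cvgB (cvgM na cc) na) (cvgM (c1 _) nb)) (cvgM nb cb))
            (cvgM (c1 _) nc)))
      (cvgM h3 (cvgM (c1 _) (cvgB (c1 _) ce)))).
  ring.
have hV := @inv_nat_cvg0 R.
apply: cvg_trans (near_eq_cvg _) _; last first.
  apply: cvg_to_eq.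
    apply: (@cvg_ratio _
      (fun n => u1 n * (2 * w n + n%:R^-1 * u1 n) + u2 n * (2 * w n + n%:R^-1 * u2 n))
      (fun n => 2 - (1 - A n))
      (fun n => (u1 n + u2 n) * (4 * w n + n%:R^-1 * (u1 n + u2 n)))
      _ (2 - 0) ((4 * p) ^+ 2 * (p * (1 - p)))) => //.
    - by rewrite mulr_gt0// exprn_gt0// mulr_gt0.
    - exact: (cvgD (cvgM h1 (cvgD (cvgM (c1 _) hw) (cvgM hV h1)))
                   (cvgM h2 (cvgD (cvgM (c1 _) hw) (cvgM hV h2)))).
    - apply: cvg_to_eq.
        exact: (cvgM (cvgD h1 h2) (cvgD (cvgM (c1 _) hw) (cvgM hV (cvgD h1 h2)))).
      ring.
  rewrite sqrtrM ?sqr_ge0// sqrtr_sqr gtr0_norm ?mulr_gt0//.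
  set S := Num.sqrt _; have S0 : 0 < S by rewrite sqrtr_gt0.
  have -> : p * (1 - p) = S * S by rewrite -expr2 sqr_sqrtr ?ltW.
  field; rewrite ?gt_eqF//.
near=> n.
have n0 : 0 < n%:R :> R by rewrite ltr0n; near: n; exact: nbhs_infty_gt.
have -> : norm_R1 n%:R p (A n) = n%:R ^+ 2 * w n + n%:R * u1 n.
  by rewrite /norm_R1 /w /u1; ring.
have -> : norm_R2 n%:R p (A n) (B n) (C n) (E n) = n%:R ^+ 2 * w n + n%:R * u2 n.
  by rewrite /norm_R2 /w /u2; ring.
have -> : norm_R12 n%:R p (B n) = n%:R ^+ 2 * w n by rewrite /norm_R12 /w; ring.
rewrite kr_quot_near_diag// [RHS]mulrAC divff ?mul1r; last first.
  by rewrite mulf_neq0 ?gt_eqF ?sqrtr_gt0.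
by congr (_ / (_ ^+ 2 * _)); ring.
Unshelve. all: by end_near.
Qed.

End Limits.

(** * Pointwise limits of the density *)

Section PointwiseLimits.
Context {R : realType} (alpha : R) (m : nat -> nat) (z : R[i]).
Hypotheses (halpha : 0 < alpha < 1)
  (hm : forall n, m n = Num.truncn (alpha * n%:R)) (z0 : 0 < cmod z).

Let x : R := cmod z ^+ 2.
Let p : R := x / (1 + x).

Let x0 : 0 < x. Proof. exact: exprn_gt0. Qed.
Let x1 : 0 < 1 + x. Proof. by rewrite addr_gt0. Qed.

Let p01 : 0 < p < 1.
Proof. by rewrite /p divr_gt0//= ltr_pdivrMr// mul1r ltrDr. Qed.

Let cmodE : cmod z = Num.sqrt x.
Proof. by rewrite /x sqrtr_sqr gtr0_norm. Qed.

Lemma lt_threshold :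
  (cmod z < Num.sqrt (alpha / (1 - alpha))) = (p < alpha).
Proof.
case/andP: halpha => a0 a1.
have t0 : 0 < alpha / (1 - alpha) by rewrite divr_gt0 ?subr_gt0.
rewrite cmodE ltr_sqrt//.
rewrite ltr_pdivlMr ?subr_gt0// ltr_pdivrMr//.
by rewrite mulrBr mulr1 ltrBlDr mulrDr mulr1 [x * alpha]mulrC.
Qed.

Lemma gt_threshold :
  (Num.sqrt (alpha / (1 - alpha)) < cmod z) = (alpha < p).
Proof.
case/andP: halpha => a0 a1.
have t0 : 0 < alpha / (1 - alpha) by rewrite divr_gt0 ?subr_gt0.
rewrite cmodE ltr_sqrt//.
rewrite ltr_pdivrMr ?subr_gt0// ltr_pdivlMr//.
by rewrite mulrBr mulr1 ltrBrDr mulrDr mulr1 [x * alpha]mulrC.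
Qed.

Let formula_near (c : nat -> R) (l : R) :
  (fun n =>
     let A := binom_cdf ((m n)%:Z - 0) (n - 0) x in
     let B := binom_cdf ((m n)%:Z - 1) (n - 1) x in
     let C := binom_cdf ((m n)%:Z - 2) (n - 2) x in
     let E := binom_cdf ((m n)%:Z - 1) (n - 2) x in
     kr_quot (1 + A) (norm_R1 n%:R p A)
       (norm_R2 n%:R p A B C E) (norm_R12 n%:R p B) / c n) @ \oo --> l ->
  (fun n => kac_rice_formula n (m n) z / c n) @ \oo --> (pi * x)^-1 * l.
Proof.
move=> h; apply: cvg_trans (near_eq_cvg _) _; last first.
  by apply: cvgM h; exact: (@cvg_cst _ (pi * x)^-1).
near=> n; rewrite kac_rice_formula_norm//; last by near: n; exact: nbhs_infty_ge.
exact: mulrA.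
Unshelve. all: by end_near.
Qed.

Lemma formula_cvg_inside : cmod z < Num.sqrt (alpha / (1 - alpha)) ->
  (fun n => kac_rice_formula n (m n) z / (n%:R * Num.sqrt n%:R)) @ \oo -->
    cmod z / (2 * pi * (1 + x) ^+ 2).
Proof.
rewrite lt_threshold => pa.
have tail i j := @binom_weight_upper R alpha x m i j halpha x0 hm pa.
have h := @kr_quot_cvg_superlinear R p _ _ _ _ p01
  (tail 0%N 0) (tail 1%N 1) (tail 2%N 2) (tail 2%N 1).
apply: cvg_to_eq; first exact: (formula_near _ _ h).
have -> : p * (1 - p) = (cmod z / (1 + x)) ^+ 2.
  by rewrite expr_div_n -/x /p; field; rewrite gt_eqF.
rewrite sqrtr_sqr gtr0_norm ?divr_gt0// /p.
have := @pi_gt0 R; move: (@pi R) => c c0; field.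
by rewrite !gt_eqF.
Qed.

Lemma formula_cvg_outside : Num.sqrt (alpha / (1 - alpha)) < cmod z ->
  (fun n => kac_rice_formula n (m n) z / n%:R) @ \oo -->
    (pi * (1 + x) ^+ 2)^-1.
Proof.
rewrite gt_threshold => ap.
have tail i j := @binom_weight_lower R alpha x m i j halpha x0 hm ap.
have h := @kr_quot_cvg_linear R p _ _ _ _ p01
  (tail 0%N 0) (tail 1%N 1) (tail 2%N 2) (tail 2%N 1).
apply: cvg_to_eq; first exact: (formula_near _ _ h).
rewrite /p; have := @pi_gt0 R; move: (@pi R) => c c0; field.
by rewrite !gt_eqF.
Qed.

End PointwiseLimits.

Lemma powR_3_2 {R : realType} (n : nat) :
  (n%:R : R) `^ (3 / 2) = n%:R * Num.sqrt n%:R.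
Proof.
have -> : 3 / 2 = 1 + 2^-1 :> R by field.
by rewrite powRD ?powRr1 ?powR12_sqrt//; apply/implyP => /eqP; lra.
Qed.

Theorem mainTheorem4 (R : realType) (d : measure_display)
    (T : measurableType d) (P : probability T R)
    (alpha : R) (m : nat -> nat)
    (a b : nat -> nat -> T -> R[i]) (rho : nat -> R[i] -> R)
    (halpha : 0 < alpha < 1)
    (hm : forall n : nat, m n = Num.truncn (alpha * n%:R))
    (hmodel : forall n : nat, truncated_model P n (m n) (a n) (b n))
    (hrho : forall n : nat,
        kac_rice_density P n (m n) (harmonic_poly n (m n) (a n) (b n)) (rho n)) :
  [/\ forall z : R[i],
        0 < cmod z < Num.sqrt (alpha / (1 - alpha)) ->
        asymp_equiv (fun n : nat => rho n z)
          (fun n : nat =>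
             (n%:R `^ (3 / 2) * cmod z) / (2 * pi * (1 + cmod z ^+ 2) ^+ 2)),
      forall z : R[i],
        Num.sqrt (alpha / (1 - alpha)) < cmod z ->
        asymp_equiv (fun n : nat => rho n z)
          (fun n : nat => n%:R / (pi * (1 + cmod z ^+ 2) ^+ 2))
    & forall z w : R[i],
        0 < cmod z < Num.sqrt (alpha / (1 - alpha)) ->
        Num.sqrt (alpha / (1 - alpha)) < cmod w ->
        (fun n : nat => rho n w / rho n z) @ \oo --> (0 : R)].
Proof.
have pos z : 0 < 1 + cmod z ^+ 2 :> R.
  by rewrite ltr_pwDl// sqr_ge0.
have rhoE n z : 0 < cmod z -> rho n z = kac_rice_formula n (m n) z.
  move=> z0; apply: (hrho n).2; apply/eqP => zE.
  by rewrite zE ComplexField.Normc.normc0 ltxx in z0.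
have inside z : 0 < cmod z < Num.sqrt (alpha / (1 - alpha)) ->
    (fun n => rho n z / (n%:R * Num.sqrt n%:R)) @ \oo -->
    cmod z / (2 * pi * (1 + cmod z ^+ 2) ^+ 2) /\
    0 < cmod z / (2 * pi * (1 + cmod z ^+ 2) ^+ 2).
  move=> /andP[z0 zt]; split.
    under eq_fun do rewrite rhoE//.
    exact: formula_cvg_inside halpha hm z0 zt.
  by rewrite divr_gt0// !mulr_gt0// ?pi_gt0// exprn_gt0.
have outside z : Num.sqrt (alpha / (1 - alpha)) < cmod z ->
    (fun n => rho n z / n%:R) @ \oo --> (pi * (1 + cmod z ^+ 2) ^+ 2)^-1 /\
    0 < (pi * (1 + cmod z ^+ 2) ^+ 2)^-1.
  move=> zt; have z0 : 0 < cmod z by apply: le_lt_trans zt; exact: sqrtr_ge0.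
  split.
    under eq_fun do rewrite rhoE//.
    exact: formula_cvg_outside halpha hm z0 zt.
  by rewrite invr_gt0 mulr_gt0 ?pi_gt0// exprn_gt0.
split.
- move=> z /inside[h L0]; rewrite /asymp_equiv.
  apply: cvg_trans (near_eq_cvg _) _; last first.
    apply: cvg_to_eq.
      exact: cvgM h (@cvg_cst _ (cmod z / (2 * pi * (1 + cmod z ^+ 2) ^+ 2))^-1 _ _ _).
    by rewrite divff// gt_eqF.
  near=> n; rewrite powR_3_2 -[_ * cmod z / _]mulrA
    [X in _ = _ * X]invfM; exact: (esym (mulrA _ _ _)).
- move=> z /outside[h L0]; rewrite /asymp_equiv.
  apply: cvg_trans (near_eq_cvg _) _; last first.
    apply: cvg_to_eq.
      exact: cvgM h (@cvg_cst _ ((pi * (1 + cmod z ^+ 2) ^+ 2)^-1)^-1 _ _ _).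
    by rewrite divff// gt_eqF.
  near=> n; rewrite [X in _ = _ * X]invfM; exact: (esym (mulrA _ _ _)).
- move=> z w /inside[hz Lz] /outside[hw Lw].
  have hS : (fun n : nat => Num.sqrt n%:R^-1) @ \oo --> (0 : R).
    rewrite -[X in _ --> X](@sqrtr0 R).
    by apply: continuous_cvg inv_nat_cvg0; exact: sqrt_continuous.
  apply: cvg_trans (near_eq_cvg _) _; last first.
    apply: cvg_to_eq; first exact: cvgM (cvgM hw (cvgV (lt0r_neq0 Lz) hz)) hS.
    exact: mulr0.
  near=> n => /=.
  have n0 : 0 < n%:R :> R by rewrite ltr0n; near: n; exact: nbhs_infty_gt.
  rewrite sqrtrV ?ltW// invfM invrK.
  have S0 : 0 < Num.sqrt n%:R :> R by rewrite sqrtr_gt0.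
  transitivity ((rho n w / (rho n z)) * (n%:R / n%:R) * (Num.sqrt n%:R / Num.sqrt n%:R)).
    by ring.
  by rewrite !divff ?gt_eqF// !mulr1.
Unshelve. all: by end_near.
Qed.
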